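(* Let $\mathcal{S}\subset\mathbb{R}^2$ be a nonempty closed and bounded set, and let $f:\mathbb{R}\to\mathbb{R}$ and $g:\mathbb{R}^2\to\mathbb{R}$ be continuous. For $\lambda\ge 0$ consider the optimization problem $$\max_{x,y}\{f(x)+\lambda g(x,y) : (x,y)\in\mathcal{S}\}.$$ If $f$ is strictly decreasing, then $\overline{x}^*(\lambda^1)\le \underline{x}^*(\lambda^2)$ for all $0\le\lambda^1<\lambda^2$.
   Context: Superscripts on $\lambda$ are indices (two different values of $\lambda$), not powers. For $\lambda\ge 0$, $\mathcal{M}(\lambda)\subseteq\mathcal{S}$ denotes the set of all maximizers $(x,y)$ of the optimization problem, and $x^*(\lambda)=\{x : \exists y,\ (x,y)\in\mathcal{M}(\lambda)\}$ is its projection onto the $x$-component. This is a nonempty compact set, and one defines $\overline{x}^*(\lambda)=\max\{x : x\in x^*(\lambda)\}$ and $\underline{x}^*(\lambda)=\min\{x : x\in x^*(\lambda)\}$. *)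

(* Defs.v *)
From HB Require Import structures.
From mathcomp Require Import all_boot all_order all_algebra.
From mathcomp Require Import all_classical all_reals all_analysis.

Set Implicit Arguments.
Unset Strict Implicit.
Unset Printing Implicit Defensive.

Import Order.TTheory GRing.Theory Num.Theory.
Import numFieldNormedType.Exports.
Local Open Scope classical_set_scope.
Local Open Scope ring_scope.

(* The greatest (least) element of A, required to belong to A, unlike
   [sup A] ([inf A]); the value is 0 when A has no such element. *)
Definition set_max (R : realType) (A : set R) : R := xget 0 (A `&` ubound A).
Definition set_min (R : realType) (A : set R) : R := xget 0 (A `&` lbound A).

Section parametric_optimization.
Context {R : realType}.
Variables (S : set (R * R)) (f : R -> R) (g : R * R -> R).

Definition objective (lambda : R) (p : R * R) : R := f p.1 + lambda * g p.

Definition maximizers (lambda : R) : set (R * R) :=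
  [set p | S p /\ forall q, S q -> objective lambda q <= objective lambda p].

Definition xstar (lambda : R) : set R :=
  [set x | exists y, maximizers lambda (x, y)].

Definition xstar_max (lambda : R) : R := set_max (xstar lambda).
Definition xstar_min (lambda : R) : R := set_min (xstar lambda).

End parametric_optimization.

(* Main.v *)
(* If p1 and p2 are optimal for lambda1 < lambda2, adding the two optimality
   inequalities gives (lambda2 - lambda1) (g p2 - g p1) >= 0, so g p1 <= g p2;
   optimality of p1 at lambda1 >= 0 then yields f p2.1 <= f p1.1, that is
   p1.1 <= p2.1 as f is strictly decreasing. *)
Require Import Defs.
From HB Require Import structures.
From mathcomp Require Import all_boot all_order all_algebra.
From mathcomp Require Import all_classical all_reals all_analysis.
From mathcomp Require Import lra.

Import Order.TTheory GRing.Theory Num.Theory.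
Import numFieldNormedType.Exports.
Local Open Scope classical_set_scope.
Local Open Scope ring_scope.

(** Heine-Borel in the plane: the norm on [R * R] is the maximum of the coordinate norms, so a
    bounded set lies in a square, which is compact as a product of two segments. *)
Lemma bounded_closed_compact_prod (R : realType) (A : set (R * R)) :
  bounded_set A -> closed A -> compact A.
Proof.
move=> [M [Mreal AM]] Acl.
(* Boundedness gives a norm bound by each number strictly above [M], hence the half-side [M + 1]. *)
have box := compact_setX (@segment_compact R (- (M + 1)) (M + 1))
                         (@segment_compact R (- (M + 1)) (M + 1)).
apply: (subclosed_compact Acl box) => -[x y] /(AM (M + 1)).
rewrite ltrDl ltr01 => /(_ isT) /=; rewrite prod_normE /= ge_max => /andP[xM yM].
by split; rewrite /= in_itv /= -ler_norml.
Qed.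

(** The witness [x] keeps [xget] from falling back on its default value 0. *)
Lemma set_max_in (R : realType) (A : set R) (x : R) :
  A x -> ubound A x -> A (set_max A).
Proof.
by move=> Ax ubx; have [] := @xgetI R 0 (A `&` ubound A) x (conj Ax ubx).
Qed.

Lemma set_min_in (R : realType) (A : set R) (x : R) :
  A x -> lbound A x -> A (set_min A).
Proof.
by move=> Ax lbx; have [] := @xgetI R 0 (A `&` lbound A) x (conj Ax lbx).
Qed.

Section maximizers.
Context {R : realType}.
Variables (S : set (R * R)) (f : R -> R) (g : R * R -> R).

Lemma continuous_objective (lambda : R) :
  continuous f -> continuous g -> continuous (objective f g lambda).
Proof.
move=> fc gc p; apply: (@continuousD R R^o (R * R)%type).
  by apply: continuous_comp; [exact: cvg_fst | exact: fc].
by apply: continuousM; [exact: cvg_cst | exact: gc].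
Qed.

Hypotheses (S_nonempty : S !=set0) (S_compact : compact S).
Hypotheses (f_continuous : continuous f) (g_continuous : continuous g).

Lemma maximizers_nonempty (lambda : R) : maximizers S f g lambda !=set0.
Proof.
have [|p /set_mem Sp pmax] := compact_EVT_max S_nonempty S_compact
    (f := objective f g lambda).
  exact/continuous_subspaceT/continuous_objective.
by exists p; split=> // q /mem_set /pmax.
Qed.

(** Given one maximizer [p], the maximizers are the points of [S] whose objective is at least that
    of [p]: a closed superlevel set cut with a compact set. *)
Lemma maximizers_compact (lambda : R) :
  closed S -> compact (maximizers S f g lambda).
Proof.
move=> S_closed; have [p [Sp pmax]] := maximizers_nonempty lambda.
have -> : maximizers S f g lambda =
    S `&` objective f g lambda @^-1` [set v | objective f g lambda p <= v].
  apply/seteqP; split=> q [Sq qmax]; split=> //; first exact: qmax.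
  by move=> r /pmax rp; exact: le_trans rp qmax.
apply: (subclosed_compact _ S_compact); last by move=> q [].
apply: closedI => //; apply: closed_comp; last exact: closed_ge.
by move=> q _; exact: continuous_objective.
Qed.

(** The continuous map [fst] attains its maximum on the nonempty compact set of maximizers, so the
    projection has a greatest element. *)
Lemma xstar_max_in (lambda : R) :
  closed S -> xstar S f g lambda (xstar_max S f g lambda).
Proof.
move=> S_closed.
have [|[x y] /set_mem Mxy xmax] := compact_EVT_max (maximizers_nonempty lambda)
    (maximizers_compact lambda S_closed) (f := fst).
  by apply: continuous_subspaceT => p; exact: cvg_fst.
apply: (@set_max_in _ _ x); first by exists y.
by move=> z [t /mem_set /xmax].
Qed.

Lemma xstar_min_in (lambda : R) :
  closed S -> xstar S f g lambda (xstar_min S f g lambda).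
Proof.
move=> S_closed.
have [|[x y] /set_mem Mxy xmin] := compact_EVT_min (maximizers_nonempty lambda)
    (maximizers_compact lambda S_closed) (f := fst).
  by apply: continuous_subspaceT => p; exact: cvg_fst.
apply: (@set_min_in _ _ x); first by exists y.
by move=> z [t /mem_set /xmin].
Qed.

End maximizers.

Lemma xstar_monotone (R : realType) (S : set (R * R)) (f : R -> R)
    (g : R * R -> R) (lambda1 lambda2 x1 x2 : R) :
  (forall x y : R, x < y -> f y < f x) ->
  0 <= lambda1 -> lambda1 < lambda2 ->
  xstar S f g lambda1 x1 -> xstar S f g lambda2 x2 -> x1 <= x2.
Proof.
move=> f_decreasing l1_ge0 l12 [y1 [S1 max1]] [y2 [S2 max2]].
have := max1 _ S2; have := max2 _ S1; rewrite /objective /= => opt2 opt1.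
rewrite leNgt; apply/negP => /f_decreasing f12.
have g12 : 0 <= g (x2, y2) - g (x1, y1).
  rewrite -(@pmulr_rge0 _ (lambda2 - lambda1)) ?subr_gt0 //.
  (* Once expanded, the goal is the sum of [opt1] and [opt2], linear in the products of a parameter
     and a value of [g]; the [f] terms cancel. *)
  by rewrite mulrBl !mulrBr; lra.
(* Passing from [(x1, y1)] to [(x2, y2)] would strictly raise [f] without lowering the [lambda1]
   term, against [opt1]. *)
by have := mulr_ge0 l1_ge0 g12; rewrite mulrBr; lra.
Qed.

Theorem corollary1 (R : realType) (S : set (R * R))
    (f : R -> R) (g : R * R -> R)
    (S_nonempty : S !=set0) (S_closed : closed S) (S_bounded : bounded_set S)
    (f_continuous : continuous f) (g_continuous : continuous g)
    (f_decreasing : forall x y : R, x < y -> f y < f x) :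
  forall lambda1 lambda2 : R, 0 <= lambda1 -> lambda1 < lambda2 ->
    xstar_max S f g lambda1 <= xstar_min S f g lambda2.
Proof.
move=> lambda1 lambda2 l1_ge0 l12.
have S_compact := bounded_closed_compact_prod _ _ S_bounded S_closed.
apply: (xstar_monotone _ _ _ _ _ _ _ _ f_decreasing l1_ge0 l12).
  exact: xstar_max_in.
exact: xstar_min_in.
Qed.
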